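(* Let $X$ be a completely regular space and let $H$ be a non-vanishing closed ideal in $C_B(X)$. The following are equivalent: (1) $\mathfrak{sp}(H)$ is connected. (2) $H$ is indecomposable, that is, $H\neq I\oplus J$ for any non-zero ideals $I$ and $J$ of $C_B(X)$.
   Context: Completely regular spaces are assumed to be Hausdorff. $C_B(X)$ is the normed algebra of continuous bounded $f:X\to\mathbb{C}$ with the supremum norm. An ideal $H$ of $C_B(X)$ is non-vanishing if for every $x\in X$ there is $h\in H$ with $h(x)\neq0$. $\mathfrak{sp}(H)$ is the Gelfand spectrum of the commutative $C^*$-algebra $H$; it is identified with the subspace $\bigcup_{h\in H}\mathrm{cl}_{\beta X}|h|^{-1}((1,\infty))$ of the Stone–Čech compactification $\beta X$. For ideals $I,J$ of $C_B(X)$, $I\oplus J$ denotes the ideal generated by $I\cup J$ (that is, $I+J$), provided that $I\cap J=\{\mathbf{0}\}$. *)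

(* Defs.v *)
From HB Require Import structures.
From mathcomp Require Import all_boot all_order all_algebra.
From mathcomp Require Import complex.
From mathcomp Require Import all_classical all_reals all_analysis.

Set Implicit Arguments.
Unset Strict Implicit.
Unset Printing Implicit Defensive.

Import Order.TTheory GRing.Theory Num.Theory.
Import numFieldNormedType.Exports.

Local Open Scope classical_set_scope.
Local Open Scope complex_scope.
Local Open Scope ring_scope.

Section BoundedContinuous.
Variables (R : realType) (X : topologicalType).

(* R[i]^o is R[i] with the topology of its absolute value. *)
Definition cb_pred : {pred X -> R[i]^o} :=
  [pred f | `[< continuous f /\ bounded_fun f >]].

Record CB := MkCB { CB_fun :> X -> R[i]^o ; CB_subproof : CB_fun \in cb_pred }.

HB.instance Definition _ := [isSub for CB_fun].
HB.instance Definition _ := [Choice of CB by <:].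

Lemma cb_predP (f : X -> R[i]^o) :
  reflect (continuous f /\ exists M : R, forall x, `|f x| <= M%:C)
    (f \in cb_pred).
Proof.
apply: (iffP (asboolP _)) => -[fc fb]; split=> //.
- have [M [Mreal fM]] := fb.
  exists (complex.Re (M + 1)) => x.
  have Mr1 : M + 1 \is Num.real by rewrite realD// real1.
  by rewrite RRe_real//; apply: fM => //=; rewrite ltrDl.
- have [M fM] := fb; exists M%:C; split.
    by rewrite complex_real.
  move=> N MN x _ /=; exact: (le_trans (fM x) (ltW MN)).
Qed.

Lemma cb_subring_closed : subring_closed cb_pred.
Proof.
split.
- apply/cb_predP; split; first by move=> x; exact: cvg_cst.
  by exists 1 => x; rewrite [X in `|X|]/(1 : R[i]) normr1.
- move=> f g /cb_predP[fc [M fM]] /cb_predP[gc [N gN]]; apply/cb_predP; split.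
    move=> x; exact: (@cvgB R[i] R[i]^o X (nbhs x) _ f g _ _ (fc x) (gc x)).
  exists (M + N) => x; rewrite rmorphD/= (le_trans (ler_normB _ _))//.
  exact: lerD.
- move=> f g /cb_predP[fc [M fM]] /cb_predP[gc [N gN]]; apply/cb_predP; split.
    move=> x.
    exact: (@cvgZ R[i] R[i]^o X (nbhs x) _ f g _ _ (fc x) (gc x)).
  exists (M * N) => x; rewrite rmorphM/= normrM.
  exact: ler_pM.
Qed.

Lemma cb_scaler_closed : GRing.scaler_closed cb_pred.
Proof.
move=> a f /cb_predP[fc [M fM]]; apply/cb_predP; split.
  move=> x; exact: (@cvgZl_tmp R[i] R[i]^o X (nbhs x) _ a f _ (fc x)).
exists (complex.Re `|a| * M) => x.
have -> : (complex.Re `|a| * M)%:C = `|a| * M%:C.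
  by rewrite -[in RHS](RRe_real (normr_real a)) -rmorphM.
by rewrite [leLHS]normrM ler_wpM2l.
Qed.

HB.instance Definition _ :=
  GRing.isSubringClosed.Build (X -> R[i]^o) cb_pred cb_subring_closed.
HB.instance Definition _ :=
  GRing.isScaleClosed.Build R[i] (X -> R[i]^o) cb_pred cb_scaler_closed.
HB.instance Definition _ :=
  GRing.SubChoice_isSubComPzRing.Build (X -> R[i]^o) cb_pred CB
    cb_subring_closed.
HB.instance Definition _ := [SubZmodule_isSubLmodule of CB by <:].

(* Valued in R[i] as required of a normed R[i]-module; sup set0 = 0 covers the
   empty space. *)
Definition sup_norm (f : CB) : R[i] :=
  (sup [set complex.Re `|f x| | x in [set: X]])%:C.

Lemma sup_norm_ub (f : CB) x : `|f x| <= sup_norm f.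
Proof.
have /cb_predP[_ [M fM]] := CB_subproof f.
rewrite -[leLHS]RRe_real// lecR; apply: ub_le_sup; last by exists x.
by exists M => _ [y _ <-]; rewrite -lecR RRe_real.
Qed.

Lemma sup_norm_ge0 (f : CB) : 0 <= sup_norm f.
Proof.
have [[x _]|X0] := pselect (exists x : X, True).
  by rewrite (le_trans _ (sup_norm_ub f x)).
rewrite /sup_norm (_ : [set _ | _ in _] = set0) ?sup0//.
by rewrite -subset0 => y [x]; case: X0; exists x.
Qed.

Lemma sup_norm_le (f : CB) (M : R[i]) : 0 <= M -> (forall x, `|f x| <= M) ->
  sup_norm f <= M.
Proof.
move=> M0 fM; rewrite -[M]RRe_real ?ger0_real// lecR.
have [->|/set0P S0] := eqVneq [set complex.Re `|f x| | x in [set: X]] set0.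
  by rewrite sup0 -lecR RRe_real ?ger0_real.
apply: ge_sup => // _ [y _ <-].
by rewrite -lecR !RRe_real ?ger0_real.
Qed.

Lemma sup_normD (f g : CB) : sup_norm (f + g) <= sup_norm f + sup_norm g.
Proof.
apply: sup_norm_le => [|x]; first by rewrite addr_ge0 ?sup_norm_ge0.
rewrite (le_trans (ler_normD (f x) (g x)))//.
by apply: lerD; exact: sup_norm_ub.
Qed.

Lemma sup_normZ (a : R[i]) (f : CB) : sup_norm (a *: f) = `|a| * sup_norm f.
Proof.
have le_sup_normZ b g : sup_norm (b *: g) <= `|b| * sup_norm g.
  apply: sup_norm_le => [|x]; first by rewrite mulr_ge0 ?sup_norm_ge0.
  by rewrite [leLHS]normrM ler_wpM2l// sup_norm_ub.
apply/le_anti; rewrite le_sup_normZ/=.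
have [->|a0] := eqVneq a 0; first by rewrite normr0 mul0r sup_norm_ge0.
rewrite -ler_pdivlMl ?normr_gt0// -normfV.
by rewrite -[f in leLHS](scalerK a0) le_sup_normZ.
Qed.

Lemma sup_norm0_eq0 (f : CB) : sup_norm f = 0 -> f = 0.
Proof.
move=> f0; apply/val_inj/funext => x; apply/eqP.
by rewrite -[_ == _]normr_le0 -f0 sup_norm_ub.
Qed.

HB.instance Definition _ :=
  @Lmodule_isNormed.Build R[i] CB sup_norm sup_normD sup_normZ sup_norm0_eq0.

End BoundedContinuous.

Arguments CB : clear implicits.

Section Ideals.
Variable A : comPzRingType.
Implicit Types I J H : set A.

(* Not the library's idealr, which excludes the whole ring. *)
Definition is_ideal I :=
  [/\ I 0, forall f g, I f -> I g -> I (f + g) &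
      forall a f, I f -> I (a * f)].

(* H is the internal direct sum of I and J: I + J is the ideal generated by
   their union, and writing it as a direct sum requires I and J to meet in 0. *)
Definition is_direct_sum H I J :=
  I `&` J = [set 0] /\ H = smallest is_ideal (I `|` J).

Definition indecomposable H :=
  forall I J, is_ideal I -> is_ideal J -> I != [set 0] -> J != [set 0] ->
    ~ is_direct_sum H I J.

End Ideals.

Section Spectrum.
Variables (R : realType) (X : topologicalType).
Implicit Type H : set (CB R X).

Definition non_vanishing H :=
  forall x : X, exists2 h : CB R X, H h & h x != 0.

(* The subtype of elements of H carries no bundled algebra structure (an ideal
   may lack a unit), so its operations are read off in C_B(X). Continuity is
   not required: characters of a C*-algebra are automatically continuous. *)
Definition is_character H (chi : H -> R[i]^o) :=
  [/\ forall (a : R[i]) (f g h : H),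
        \val h = a *: \val f + \val g -> chi h = a * chi f + chi g,
      forall f g h : H, \val h = \val f * \val g -> chi h = chi f * chi g &
      exists f : H, chi f != 0].

(* As a subspace of the space of pointwise convergence, this set carries the
   weak-star (Gelfand) topology. *)
Definition gelfand_spectrum H : set {ptws H -> R[i]^o} :=
  [set chi | is_character chi].

End Spectrum.

Arguments is_character {R X} H chi.
Arguments gelfand_spectrum {R X} H _.

(* Main.v *)
Require Import Defs.
From HB Require Import structures.
From mathcomp Require Import all_boot all_order all_algebra.
From mathcomp Require Import complex.
From mathcomp Require Import all_classical all_reals all_analysis.

Import Order.TTheory GRing.Theory Num.Theory.
Import numFieldNormedType.Exports.

Local Open Scope classical_set_scope.
Local Open Scope ring_scope.

(* If H = I + J with I and J meeting in 0, then IJ = 0, so the characters that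
   are nonzero on I and those that are nonzero on J are disjoint open sets
   covering sp(H), and evaluations at points of X show that both are nonempty.

   Conversely, a clopen piece of sp(H) pulls back along x |-> (evaluation at x)
   to a clopen set P of X, and the idempotent e = 1_P of C_B(X) splits H as
   eH + (1 - e)H. Both summands are nonzero because evaluations are dense in
   sp(H): a character of H extends to C_B(X), and a function k in the kernel of
   the extension cannot be bounded away from 0, being otherwise invertible;
   finitely many such conditions combine into one through
   |k1|^2 + |k2|^2 = conj(k1) k1 + conj(k2) k2, which is again in the kernel.
   Hence the sets {|k| < 1} generate a proper filter on X along which the
   evaluations converge to the character. *)

(** The topology is the supremum of those induced by the coordinate maps; each of these is onto, as
    constant functions show, which is what [cvg_image] asks for. *)
Lemma ptws_cvgP (U : Type) (V : topologicalType) (F : set_system {ptws U -> V})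
    (f : {ptws U -> V}) : Filter F ->
  F --> f <-> forall t : U, (fun g : {ptws U -> V} => g t) @ F --> f t.
Proof.
move=> FF; rewrite cvg_sup; split=> Ff t.
- move: (Ff t); rewrite cvg_image; last first.
    by rewrite eqEsubset; split=> v // _; exists (fun=> v).
  apply: cvg_trans => W /=; rewrite ?nbhs_simpl /fmap /= => -[W' + <-].
  by apply: filterS => g W'g /=; exists g.
- rewrite cvg_image; last first.
    by rewrite eqEsubset; split=> v // _; exists (fun=> v).
  move: (Ff t) => + W /=; rewrite ?nbhs_simpl => Q /Q Q'.
  exists ((fun g => g t) @^-1` W) => //.
  by rewrite eqEsubset; split => [j [? + <-//]|j Wj]; exists (fun=> j).
Qed.

(** * Conjugates, inverses and indicators in C_B(X) *)

Section Functions.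
Variables (R : realType) (X : topologicalType).
Implicit Types (f k : CB R X) (P : set X).

Lemma cb_conj_subproof f : (fun x => (f x)^* : R[i]^o)%C \in @cb_pred R X.
Proof.
have /cb_predP[fc [M fM]] := CB_subproof f; apply/cb_predP; split; last first.
  by exists M => x; rewrite [leLHS]norm_conjC.
move=> x; apply/cvgrPdist_lt => e e0.
have /cvgrPdist_lt/(_ e e0) := fc x; apply: filterS => y.
by rewrite -[X in _ -> X < _]norm_conjC rmorphB /= !conjCK.
Qed.

Definition cb_conj f : CB R X := MkCB (cb_conj_subproof f).

(** The uniform lower bound, stronger than having no zero, keeps the inverse bounded. *)
Lemma cb_inv_subproof f : (forall x, 1 <= `|f x|) ->
  (fun x => (f x : R[i])^-1 : R[i]^o) \in @cb_pred R X.
Proof.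
have /cb_predP[fc _] := CB_subproof f => f1; apply/cb_predP; split.
  move=> x; apply: (@cvgV R[i] X (nbhs x) _ f (f x)); last exact: fc.
  by rewrite -normr_gt0; apply: lt_le_trans (f1 x).
by exists 1 => x; rewrite [leLHS]normfV invf_le1 // (lt_le_trans _ (f1 x)).
Qed.

Definition cb_cst (a : R[i]) : CB R X := a *: (1 : CB R X).

(** Reduces scalars to ring multiplication, the only multiplication in [is_ideal]. *)
Lemma cb_scaleE (a : R[i]) f : a *: f = cb_cst a * f.
Proof.
apply/val_inj/funext => x.
by change (a * f x = (a * 1) * f x); rewrite mulr1.
Qed.

Lemma cb_unit f : (forall x, 1 <= `|f x|) -> exists g : CB R X, g * f = 1.
Proof.
move=> f1; exists (MkCB (cb_inv_subproof f f1)).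
apply/val_inj/funext => x /=; apply: (@mulVf R[i]).
by rewrite -normr_gt0; apply: lt_le_trans (f1 x).
Qed.

Lemma cb_indic_subproof P : open P -> closed P ->
  (fun x => (\1_P x : R[i]) : R[i]^o) \in @cb_pred R X.
Proof.
move=> oP cP; apply/cb_predP; split; last first.
  exists 1 => x; rewrite indicE.
  by case: (_ \in _); rewrite ?normr1 ?normr0 ?ler01.
move=> x; apply/cvgrPdist_lt => e e0; have [Px|nPx] := pselect (P x).
  apply: (@filterS _ _ _ P); last exact: open_nbhs_nbhs.
  by move=> y Py; rewrite !indicE !mem_set// subrr normr0.
apply: (@filterS _ _ _ (~` P)).
  by move=> y Py; rewrite !indicE !memNset// subrr normr0.
by apply: open_nbhs_nbhs; split=> //; exact: closed_openC.
Qed.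

Definition cb_indic P (oP : open P) (cP : closed P) : CB R X :=
  MkCB (cb_indic_subproof P oP cP).

End Functions.

Arguments cb_cst {R X} a.
Arguments cb_conj {R X} f.
Arguments cb_unit {R X} f.
Arguments cb_scaleE {R X} a f.

(** * Characters as limits of evaluations *)

Section Characters.
Variables (R : realType) (X : topologicalType) (H : set (CB R X)).
Hypothesis Hideal : is_ideal H.
Implicit Types (f g k : CB R X) (chi : {ptws H -> R[i]^o}).

Lemma ideal_scale (a : R[i]) f : H f -> H (a *: f).
Proof. by have [_ _ HM] := Hideal => Hf; rewrite cb_scaleE; exact: HM. Qed.

Definition ideal_elt f (Hf : H f) : H := exist _ f (mem_set Hf).

Lemma ideal_valP (h : H) : H (\val h).
Proof. exact: set_mem (valP h). Qed.

Lemma characterD chi (f g h : H) : is_character H chi ->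
  \val h = \val f + \val g -> chi h = chi f + chi g.
Proof.
move=> [lin _ _] hE; rewrite -[chi f]mul1r; apply: lin.
by rewrite scale1r.
Qed.

Lemma character0 chi (h : H) : is_character H chi -> \val h = 0 -> chi h = 0.
Proof.
move=> ch h0; apply: (addrI (chi h)); rewrite addr0.
by rewrite -(@characterD chi h h h ch)// h0 addr0.
Qed.

Definition evaluation (x : X) : {ptws H -> R[i]^o} := fun h => \val h x.

Lemma evaluation_character x : (exists2 h : CB R X, H h & h x != 0) ->
  is_character H (evaluation x).
Proof.
move=> [h Hh hx]; split; last by exists (ideal_elt h Hh).
- by move=> a f g k /(congr1 (fun u : CB R X => u x)).
- by move=> f g k /(congr1 (fun u : CB R X => u x)).
Qed.

Lemma evaluation_continuous : continuous evaluation.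
Proof.
move=> x; apply/ptws_cvgP => h.
have /cb_predP[hc _] := CB_subproof (\val h); exact: hc.
Qed.

(* The character [chi] extends to C_B(X) by [k |-> chi (k * f) / chi f] for any
   [f] with [chi f != 0]; this is the kernel of the extension, described without
   choosing [f]. *)
Definition extension_kernel chi k :=
  forall f g : H, \val g = k * \val f -> chi g = 0.

Lemma extension_kernelD chi k1 k2 : is_character H chi ->
  extension_kernel chi k1 -> extension_kernel chi k2 ->
  extension_kernel chi (k1 + k2).
Proof.
move=> ch k10 k20 f g gE; have [_ _ HM] := Hideal.
pose g1 := ideal_elt _ (HM k1 _ (ideal_valP f)).
pose g2 := ideal_elt _ (HM k2 _ (ideal_valP f)).
rewrite (characterD _ g1 g2) ?(k10 f g1) ?(k20 f g2) ?addr0//.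
by rewrite gE mulrDl.
Qed.

(** The factor [a] is absorbed by the ideal: (a k) f = k (a f), with a f in [H]. *)
Lemma extension_kernelM chi a k :
  extension_kernel chi k -> extension_kernel chi (a * k).
Proof.
move=> k0 f g gE; have [_ _ HM] := Hideal.
apply: (k0 (ideal_elt _ (HM a _ (ideal_valP f)))).
by rewrite gE mulrAC mulrC.
Qed.

Lemma extension_kernelZ chi (a : R[i]) k :
  extension_kernel chi k -> extension_kernel chi (a *: k).
Proof.
move=> k0 f g gE; apply: (k0 (ideal_elt _ (ideal_scale a _ (ideal_valP f)))).
by rewrite gE /= (cb_scaleE a k) (cb_scaleE a (\val f)) mulrCA mulrA.
Qed.

Lemma extension_kernel_proper chi : is_character H chi ->
  ~ extension_kernel chi 1.
Proof.
by move=> [_ _ [f fN0]] k0; move: fN0; rewrite (k0 f f) ?mul1r// eqxx.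
Qed.

(** By multiplicativity chi (h f) = chi h * chi f, so the extension still takes the value [chi h] at
    [h]. *)
Lemma extension_kernel_sub chi (h : H) : is_character H chi ->
  extension_kernel chi (\val h - cb_cst (chi h)).
Proof.
move=> ch f g gE; have [lin mul _] := ch; have [_ _ HM] := Hideal.
pose hf := ideal_elt _ (HM (\val h) _ (ideal_valP f)).
have hfE : chi hf = chi h * chi f by exact: mul.
have := lin (- chi h) f hf g; rewrite hfE mulNr addNr; apply.
by rewrite gE mulrBl addrC scaleNr -cb_scaleE.
Qed.

(** The kernel is stable under scalars, so the threshold 1 stands for every positive one. *)
Definition character_filter chi : set_system X :=
  [set S | exists2 k, extension_kernel chi k & [set x | `|k x| < 1] `<=` S].

Lemma character_filter_proper chi : is_character H chi ->
  ProperFilter (character_filter chi).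
Proof.
move=> ch; split.
  move=> [k k0 kS]; have [x|g gk] := cb_unit k.
    by rewrite real_leNgt ?normr_real ?real1//; apply/negP => /kS.
  apply: (extension_kernel_proper chi ch).
  by rewrite -gk; apply: extension_kernelM.
split.
- exists 0 => // f g gE; by apply: (character0 chi _ ch); rewrite gE mul0r.
- move=> A B [k1 k10 k1A] [k2 k20 k2B].
  exists (cb_conj k1 * k1 + cb_conj k2 * k2).
    by apply: extension_kernelD => //; exact: extension_kernelM.
  move=> x /=.
  rewrite [X in `|X| < 1](_ : _ = (`|k1 x| ^+ 2 + `|k2 x| ^+ 2 : R[i]));
    last first.
    by rewrite !normCK mulrC [X in _ + X]mulrC.
  rewrite ger0_norm ?addr_ge0 ?exprn_ge0// => lt1.
  by split; [apply: k1A | apply: k2B] => /=;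
    rewrite -(@expr_lt1 _ 2)//; apply: le_lt_trans lt1;
    rewrite ?lerDl ?lerDr exprn_ge0.
- by move=> A B AB [k k0 kA]; exists k => //; apply: subset_trans AB.
Qed.

Lemma evaluation_cvg chi : is_character H chi ->
  evaluation x @[x --> character_filter chi] --> chi.
Proof.
move=> ch; have PF := character_filter_proper chi ch.
apply/ptws_cvgP => h; apply/cvgrPdist_lt => e e0.
(* This kernel element has modulus below 1 at x exactly when h x is within [e] of [chi h]. *)
exists (e^-1 *: (\val h - cb_cst (chi h))).
  by apply: extension_kernelZ; exact: extension_kernel_sub.
move=> x /=; rewrite [X in X < 1 -> _]normrM gtr0_norm ?invr_gt0//.
rewrite ltr_pdivrMl// mulr1 distrC; congr (`| _ - _| < _).
exact: mulr1.
Qed.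

Lemma evaluation_dense (C : set {ptws H -> R[i]^o}) chi :
  open C -> C chi -> is_character H chi -> exists x, C (evaluation x).
Proof.
move=> oC Cchi ch; have PF := character_filter_proper chi ch.
have : character_filter chi (evaluation @^-1` C).
  exact: (evaluation_cvg chi ch C (open_nbhs_nbhs (conj oC Cchi))).
by move=> /(@filter_ex _ _ PF).
Qed.

End Characters.

Arguments ideal_elt {R X} H f Hf.
Arguments ideal_valP {R X} H h.
Arguments evaluation {R X} H x.
Arguments evaluation_character {R X} H x.
Arguments evaluation_continuous {R X} H.
Arguments evaluation_dense {R X} H Hideal C chi.
Arguments character0 {R X} H chi h.
Arguments characterD {R X} H chi f g h.

(** * Sums of ideals and splitting by an idempotent *)

Section Ideals.
Variable A : comPzRingType.
Implicit Types (I J H : set A).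

Lemma is_ideal_sum I J : is_ideal I -> is_ideal J ->
  is_ideal [set f + g | f in I & g in J].
Proof.
move=> [I0 ID IM] [J0 JD JM]; split.
- by exists 0 => //; exists 0 => //; rewrite addr0.
- move=> _ _ [f1 If1 [g1 Jg1 <-]] [f2 If2 [g2 Jg2 <-]].
  exists (f1 + f2); first exact: ID.
  by exists (g1 + g2); [exact: JD|rewrite addrACA].
- move=> a _ [f If [g Jg <-]]; exists (a * f); first exact: IM.
  by exists (a * g); [exact: JM|rewrite mulrDr].
Qed.

Lemma smallest_is_ideal_setU I J : is_ideal I -> is_ideal J ->
  smallest (@is_ideal A) (I `|` J) = [set f + g | f in I & g in J].
Proof.
move=> II IJ; have [I0 _ _] := II; have [J0 _ _] := IJ.
apply/seteqP; split.
  apply: smallest_sub; first exact: is_ideal_sum.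
  move=> f [If|Jf]; first by exists f => //; exists 0 => //; rewrite addr0.
  by exists 0 => //; exists f => //; rewrite add0r.
move=> _ [f If [g Jg <-]] K [[_ KD _] IJK].
by apply: KD; apply: IJK; [left|right].
Qed.

Lemma ideal_neq0 I : is_ideal I -> I != [set 0] -> exists2 f, I f & f != 0.
Proof.
move=> [I0 _ _] IN0; apply: contrapT => nI; move/eqP: IN0; apply.
apply/seteqP; split=> [f If|_ ->//]; apply/eqP/negPn/negP => f0.
by apply: nI; exists f.
Qed.

Lemma is_ideal_scale H (e : A) : is_ideal H -> is_ideal [set e * h | h in H].
Proof.
move=> [H0 HD HM]; split.
- by exists 0; rewrite ?mulr0.
- move=> _ _ [f Hf <-] [g Hg <-]; exists (f + g); rewrite ?mulrDr//.
  exact: HD.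
- by move=> a _ [f Hf <-]; exists (a * f); rewrite 1?mulrCA//; exact: HM.
Qed.

(** Multiplication by [e] both fixes and kills a common element of the two summands, and h = e h +
    (1 - e) h. *)
Lemma idempotent_direct_sum H (e : A) : is_ideal H -> e * e = e ->
  is_direct_sum H [set e * h | h in H] [set (1 - e) * h | h in H].
Proof.
move=> Hideal ee; have [H0 HD HM] := Hideal; split.
  apply/seteqP; split=> [_ [[f Hf <-] [g Hg gE]]|_ ->].
    by rewrite /= -ee -mulrA -gE mulrA mulrBr mulr1 ee subrr mul0r.
  by split; exists 0; rewrite ?mulr0.
rewrite smallest_is_ideal_setU; [|exact: is_ideal_scale..].
apply/seteqP; split=> [h Hh|_ [_ [f Hf <-] [_ [g Hg <-] <-]]].
  exists (e * h); first by exists h.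
  exists ((1 - e) * h); first by exists h.
  by rewrite -mulrDl addrC subrK mul1r.
by apply: HD; exact: HM.
Qed.

End Ideals.

(** * Clopen pieces of the spectrum and decompositions of the ideal *)

Section Spectrum.
Variables (R : realType) (X : topologicalType) (H : set (CB R X)).
Hypothesis Hideal : is_ideal H.

Lemma ptws_coord_open (h : H) : open [set chi : {ptws H -> R[i]^o} | chi h != 0].
Proof.
rewrite (_ : [set _ | _] =
    (fun chi : {ptws H -> R[i]^o} => chi h) @^-1` (~` [set 0])).
  apply: open_comp.
    move=> chi _.
    exact: (ptws_cvgP _ _ _ chi (nbhs_filter chi)).1.
  apply: closed_openC; apply: accessible_closed_set1.
  apply: hausdorff_accessible; exact: norm_hausdorff.
by apply/seteqP; split=> chi /eqP.
Qed.

(** On the spectrum this is the complement of the hull of the part of [I] lying in [H]. *)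
Definition nonzero_on (I : set (CB R X)) : set {ptws H -> R[i]^o} :=
  \bigcup_(h in [set h : H | I (\val h)]) [set chi | chi h != 0].

Lemma nonzero_on_open I : open (nonzero_on I).
Proof. by apply: bigcup_open => h _; exact: ptws_coord_open. Qed.

Lemma connected_indecomposable :
  connected (gelfand_spectrum H) -> indecomposable H.
Proof.
move=> Hconn I J Iideal Jideal IN0 JN0 [IJ0 HIJ].
rewrite smallest_is_ideal_setU// in HIJ.
have [I0 _ IM] := Iideal; have [J0 _ JM] := Jideal.
have IH : I `<=` H.
  by move=> f If; rewrite HIJ; exists f => //; exists 0; rewrite ?addr0.
have JH : J `<=` H.
  by move=> f Jf; rewrite HIJ; exists 0 => //; exists f; rewrite ?add0r.
have disj chi : is_character H chi -> nonzero_on I chi -> nonzero_on J chi ->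
    False.
  move=> ch [f If /= cf] [g Jg /= cg]; have [H0 _ _] := Hideal.
  have fg0 : \val f * \val g = 0.
    have : (I `&` J) (\val f * \val g).
      by split; [rewrite mulrC; exact: IM|exact: JM].
    by rewrite IJ0.
  have [_ mul _] := ch.
  have : chi (ideal_elt H 0 H0) = chi f * chi g by apply: mul; rewrite fg0.
  rewrite (character0 H chi)// => /esym/eqP.
  by rewrite (@mulf_eq0 R[i]) (negPf cf) (negPf cg).
(* Split some h with [chi h] nonzero as f + g: [chi] cannot vanish on both terms. *)
have cover chi : is_character H chi -> nonzero_on I chi \/ nonzero_on J chi.
  move=> ch; have [_ _ [h hN0]] := ch.
  have := ideal_valP H h; rewrite [X in X (\val h) -> _]HIJ => -[f If [g Jg fgE]].
  have hE := characterD H chi (ideal_elt H f (IH _ If))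
    (ideal_elt H g (JH _ Jg)) h ch (esym fgE).
  have [cf|cf] := eqVneq (chi (ideal_elt H f (IH _ If))) 0.
    right; exists (ideal_elt H g (JH _ Jg)) => //=.
    by move: hN0; rewrite hE cf add0r.
  by left; exists (ideal_elt H f (IH _ If)).
(* Evaluate at a point where some f in [K] is nonzero; f lies in [H], so this evaluation is a
   character of [H]. *)
have ex K : K `<=` H -> is_ideal K -> K != [set 0] ->
    exists2 chi, is_character H chi & nonzero_on K chi.
  move=> KH Kideal /(ideal_neq0 _ _ Kideal)[f Kf fN0].
  have [x fx] : exists x, f x != 0.
    apply: contrapT => nf; move/eqP: fN0; apply.
    apply/val_inj/funext => x; apply/eqP/negPn/negP => fx; apply: nf.
    by exists x.
  exists (evaluation H x).
    by apply: evaluation_character; exists f => //; exact: KH.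
  by exists (ideal_elt H f (KH _ Kf)).
have [chi1 ch1 I1] := ex I IH Iideal IN0.
have [chi2 ch2 J2] := ex J JH Jideal JN0.
(* Within the spectrum [nonzero_on I] is also the trace of the closed complement of [nonzero_on J],
   hence relatively clopen. *)
have /seteqP[_] : gelfand_spectrum H `&` nonzero_on I = gelfand_spectrum H.
  apply: Hconn; first by exists chi1.
  - by exists (nonzero_on I) => //; exact: nonzero_on_open.
  - exists (~` nonzero_on J); first exact/open_closedC/nonzero_on_open.
    apply/seteqP; split=> chi [ch c]; split => //; first exact: disj.
    by case: (cover chi ch).
by move=> /(_ chi2 ch2)[_ I2]; exact: (disj chi2).
Qed.

Lemma indecomposable_connected : non_vanishing H ->
  indecomposable H -> connected (gelfand_spectrum H).
Proof.
move=> Hnv Hind B [chi1 B1] [C oC BC] [D cD BD].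
apply: contrapT => BN.
have ev_ch x : is_character H (evaluation H x).
  by apply: evaluation_character; exact: Hnv.
(* The open [C] and the closed [D] both cut out [B] on the spectrum, so they have the same preimage
   in X, which is therefore clopen. *)
have CD x : C (evaluation H x) <-> D (evaluation H x).
  have : (gelfand_spectrum H `&` C) (evaluation H x) <->
         (gelfand_spectrum H `&` D) (evaluation H x) by rewrite -BC -BD.
  by have := ev_ch x; rewrite /gelfand_spectrum /=; tauto.
have ev_cont := evaluation_continuous H.
pose P := evaluation H @^-1` C.
have oP : open P by apply: open_comp => // x _; exact: ev_cont.
have cP : closed P.
  rewrite (_ : P = evaluation H @^-1` D); last by apply/seteqP; split=> x /CD.
  by move/continuous_closedP: ev_cont; exact.
(* As [B] is not the whole spectrum, the open complement of [D] contains a character; density then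
   yields a point outside [P]. *)
have [chi2 ch2 nD2] : exists2 chi, is_character H chi & (~` D) chi.
  apply: contrapT => nex; apply: BN; rewrite BD; apply/seteqP.
  split=> [chi []//|chi ch]; split=> //.
  by apply: contrapT => nD; apply: nex; exists chi.
have [x1 Px1] : exists x, P x.
  move: B1; rewrite BC => -[ch1 C1].
  exact: (evaluation_dense H Hideal C chi1).
have [x2 nPx2] : exists x, ~ P x.
  have [x nDx] := evaluation_dense H Hideal _ chi2 (closed_openC cD) nD2 ch2.
  by exists x => /CD.
pose e := cb_indic R X P oP cP.
have ee : e * e = e.
  apply/val_inj/funext => x.
  change ((\1_P x : R[i]) * \1_P x = \1_P x).
  by rewrite indicE; case: (_ \in _); rewrite ?mulr1 ?mulr0.
(* Non-vanishing provides h in [H] with h x nonzero, and u h takes the same value at x. *)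
have split_neq0 (u : CB R X) x : u x = 1 -> [set u * h | h in H] != [set 0].
  move=> ux; have [h Hh /eqP hx] := Hnv x; apply/eqP => E.
  have : [set u * h | h in H] (u * h) by exists h.
  rewrite E => /(congr1 (fun v : CB R X => v x)) uh0; apply: hx.
  by have : u x * h x = 0 :> R[i]; [exact: uh0|rewrite ux mul1r].
apply: (Hind _ _ _ _ _ _ (idempotent_direct_sum _ H e Hideal ee)).
- exact: is_ideal_scale.
- exact: is_ideal_scale.
- apply: (split_neq0 e x1).
  by change ((\1_P x1 : R[i]) = 1); rewrite indicE mem_set.
- apply: (split_neq0 (1 - e) x2).
  by change (1 - (\1_P x2 : R[i]) = 1); rewrite indicE memNset// subr0.
Qed.

End Spectrum.

Theorem theorem3p2p11 (R : realType) (X : topologicalType)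
    (Xcr : completely_regular_space X) (XT2 : hausdorff_space X)
    (H : set (CB R X)) (Hideal : is_ideal H) (Hclosed : closed H)
    (Hnv : non_vanishing H) :
  connected (gelfand_spectrum H) <-> indecomposable H.
Proof.
split; first exact: connected_indecomposable.
exact: indecomposable_connected.
Qed.
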